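(* Assume the following Conjecture holds: for every positive integer $n$ and every system $T\subseteq\{x_i+1=x_k,\ x_i\cdot x_j=x_k:\ i,j,k\in\{1,\ldots,n\}\}$ which has only finitely many solutions in positive integers $x_1,\ldots,x_n$, each such solution satisfies $x_1,\ldots,x_n\leqslant f(n)$. Then every set $\mathcal{M}\subseteq\mathbb{N}$ which has a finite-fold Diophantine representation is computable.
   Context: $\mathbb{N}=\{0,1,2,\ldots\}$. Define $f:\mathbb{N}\setminus\{0\}\to\mathbb{N}\setminus\{0\}$ by $f(1)=1$, $f(n)=2^{2^{n-2}}$ for $n\in\{2,3,4,5\}$, and $f(n)=\left(2+2^{2^{n-4}}\right)^{2^{n-4}}$ for $n\geqslant 6$. A set $\mathcal{M}\subseteq\mathbb{N}$ has a finite-fold Diophantine representation if there is a polynomial $W(x,x_1,\ldots,x_m)$ with integer coefficients such that for every $b\in\mathbb{N}$: $b\in\mathcal{M}$ if and only if there exist $x_1,\ldots,x_m\in\mathbb{N}$ with $W(b,x_1,\ldots,x_m)=0$, and for every $b\in\mathbb{N}$ the equation $W(b,x_1,\ldots,x_m)=0$ has only finitely many solutions $(x_1,\ldots,x_m)\in\mathbb{N}^m$. *)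

(* Defs.v *)
From mathcomp Require Import all_boot all_order all_algebra.
From mathcomp Require Import boolp classical_sets functions cardinality.
From mathcomp Require Import mpoly.

Set Implicit Arguments.
Unset Strict Implicit.
Unset Printing Implicit Defensive.

Import GRing.Theory.
Local Open Scope classical_set_scope.
Local Open Scope nat_scope.

(* The intended domain is n > 0; the value at 0 is irrelevant. *)
Definition f (n : nat) : nat :=
  if n <= 1 then 1
  else if n <= 5 then 2 ^ (2 ^ (n - 2))
  else (2 + 2 ^ (2 ^ (n - 4))) ^ (2 ^ (n - 4)).

(* The variables x_1, ..., x_n are indexed by 'I_n, that is by 0, ..., n-1. *)
Inductive equation (n : nat) : Type :=
| EqSucc of 'I_n & 'I_n
| EqMul of 'I_n & 'I_n & 'I_n.

Definition satisfies (n : nat) (x : n.-tuple nat) (e : equation n) : Prop :=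
  match e with
  | EqSucc i k => tnth x i + 1 = tnth x k
  | EqMul i j k => tnth x i * tnth x j = tnth x k
  end.

Definition positive_solutions (n : nat) (T : set (equation n)) :
    set (n.-tuple nat) :=
  [set x : n.-tuple nat | (forall i, 0 < tnth x i) /\ (forall e, T e -> satisfies x e)].

(* In W the variable of index 0 is the parameter; the variables of index
   1, ..., m are the unknowns. *)
Definition natural_solutions (m : nat) (W : {mpoly int[m.+1]}) (b : nat) :
    set (m.-tuple nat) :=
  [set x : m.-tuple nat | W.@[fun i => Posz (tnth (cons_tuple b x) i)] = 0%R].

Definition finite_fold_diophantine (M : set nat) : Prop :=
  exists (m : nat) (W : {mpoly int[m.+1]}),
    (forall b, M b <-> exists x, natural_solutions W b x) /\
    (forall b, finite_set (natural_solutions W b)).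

(* Codes for the k-ary partial recursive functions. *)
Inductive recfun : nat -> Type :=
| RZero k : recfun k
| RSucc : recfun 1
| RProj k : 'I_k -> recfun k
| RComp k m : recfun m -> ('I_m -> recfun k) -> recfun k
| RPrim k : recfun k -> recfun k.+2 -> recfun k.+1
| RMu k : recfun k.+1 -> recfun k.

(* The graph of the function defined by primitive recursion from the graph
   base of the initial value and the graphs step n z of the successive values. *)
Fixpoint iterates (base : nat -> Prop) (step : nat -> nat -> nat -> Prop)
    (n : nat) : nat -> Prop :=
  match n with
  | 0 => base
  | n'.+1 => fun y => exists z, iterates base step n' z /\ step n' z y
  end.

(* computes c v y: the function coded by c is defined at v, with value y.
   Primitive recursion is on the first argument, its step function taking the
   previous index, the previous value and the parameters in this order;
   minimization is over the first argument, and requires the minimized function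
   to be defined at all smaller values. *)
Fixpoint computes (k : nat) (c : recfun k) : k.-tuple nat -> nat -> Prop :=
  match c in recfun k return k.-tuple nat -> nat -> Prop with
  | RZero _ => fun _ y => y = 0
  | RSucc => fun v y => y = (thead v).+1
  | RProj _ i => fun v y => y = tnth v i
  | RComp _ m g h => fun v y =>
      exists w : m.-tuple nat,
        (forall i, computes (h i) v (tnth w i)) /\ computes g w y
  | RPrim k g h => fun v =>
      let p : k.-tuple nat := behead_tuple v in
      iterates (computes g p)
        (fun n z => computes h (cons_tuple n (cons_tuple z p))) (thead v)
  | RMu _ g => fun v y =>
      computes g (cons_tuple y v) 0 /\
      (forall z, z < y -> exists r, computes g (cons_tuple z v) r.+1)
  end.

(* The characteristic function of M is (total) recursive. *)
Definition computable (M : set nat) : Prop :=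
  exists c : recfun 1, forall b,
    (M b -> computes c [tuple b] 1) /\ (~ M b -> computes c [tuple b] 0).

(* Main.v *)
Require Import Defs.
From mathcomp Require Import all_boot all_order all_algebra.
From mathcomp Require Import boolp classical_sets functions cardinality.
From mathcomp Require Import mpoly.
From mathcomp Require Import zify ring.

(** Shifting the unknowns by 1 turns W(b, x) = 0 into an equality P(u) = Q(u)
    between two expressions in 1, + and * over positive integers. Naming all
    intermediate values (addition being expressed by Robinson's identity) and
    forcing the shifted parameter by a chain 1, 2, ..., b + 1 gives a system in
    N + b variables, with N independent of b, whose positive solutions correspond
    bijectively to the solutions of W(b, x) = 0. The Conjecture then bounds these
    by f(N + b), so membership in M is decided by a bounded search, which is
    primitive recursive. *)

Set Implicit Arguments.
Unset Strict Implicit.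
Unset Printing Implicit Defensive.

Import GRing.Theory.

(** * Recursive functions *)

(** Functions act on lists of any length, so that arguments can be prepended or dropped without
    casts; only lists of length [k] matter. *)
Definition computed (k : nat) (F : seq nat -> nat) : Prop :=
  exists c : recfun k, forall v : k.-tuple nat, computes c v (F v).

Lemma eq_computed k (F G : seq nat -> nat) :
  (forall v, size v = k -> F v = G v) -> computed k F -> computed k G.
Proof.
by move=> eFG [c Hc]; exists c => v; rewrite -eFG ?size_tuple //; apply: Hc.
Qed.

Lemma computed_comp k m (G : seq nat -> nat) (H : nat -> seq nat -> nat) :
  computed m G -> (forall i, i < m -> computed k (H i)) ->
  computed k (fun v => G (mkseq (H^~ v) m)).
Proof.
move=> [c Hc] HH.
have HH' (i : 'I_m) : exists d : recfun k,
    forall v : k.-tuple nat, computes d v (H i v) by exact: HH.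
have [d Hd] := boolp.choice HH'.
exists (RComp c d) => v /=.
exists (Tuple (introT eqP (size_mkseq (H^~ v) m))); split; last exact: Hc.
by move=> i; rewrite (tnth_nth 0) nth_mkseq.
Qed.

Lemma computed_nth k i : i < k -> computed k (fun v => nth 0 v i).
Proof.
by move=> ik; exists (RProj (Ordinal ik)) => v /=; rewrite (tnth_nth 0).
Qed.

Lemma computed_succ k F : computed k F -> computed k (fun v => (F v).+1).
Proof.
move=> cF; apply: (@computed_comp k 1 (fun w => (nth 0 w 0).+1) (fun _ => F)) => //.
by exists RSucc => v /=; rewrite /thead (tnth_nth 0).
Qed.

Lemma computed_const k n : computed k (fun _ => n).
Proof.
elim: n => [|n]; first by exists (RZero k).
exact: computed_succ.
Qed.

Lemma computed_drop j k F :
  computed k F -> computed (j + k) (fun v => F (drop j v)).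
Proof.
move=> cF; apply: (@eq_computed _ (fun v => F (mkseq (fun i => nth 0 v (j + i)) k))).
  move=> v sv; congr (F _); apply: (@eq_from_nth _ 0).
    by rewrite size_mkseq size_drop sv addKn.
  by move=> i; rewrite size_mkseq => ik; rewrite nth_mkseq // nth_drop.
apply: (computed_comp (H := fun i v => nth 0 v (j + i))) => // i ik.
by apply: computed_nth; rewrite ltn_add2l.
Qed.

(** [RPrim] recurses on its first argument: the loop is coded as [R], which takes the number of
    rounds in front of the parameters, and [N v] is then substituted there. *)
Lemma computed_iteri k (N G H : seq nat -> nat) :
  computed k N -> computed k G -> computed k.+2 H ->
  computed k (fun v => iteri (N v) (fun i a => H [:: i, a & v]) (G v)).
Proof.
move=> cN [g Hg] [h Hh].
pose R w := iteri (head 0 w) (fun i a => H [:: i, a & behead w]) (G (behead w)).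
have cR : computed k.+1 R.
  exists (RPrim g h) => v /=.
  rewrite /R; have -> : head 0 v = thead v by rewrite /thead (tnth_nth 0) nth0.
  elim: (thead v) => [|n IHn] /=; first exact: (Hg (behead_tuple v)).
  by eexists; split; [exact: IHn | exact: (Hh (cons_tuple _ (cons_tuple _ _)))].
pose S i v := if i is j.+1 then nth 0 v j else N v.
apply: (@eq_computed _ (fun v => R (mkseq (S^~ v) k.+1))).
  move=> v sv; suff -> : mkseq (S^~ v) k.+1 = N v :: v by [].
  by rewrite /mkseq /= (iotaDl 1 0) -map_comp -[in iota 0 k]sv [map _ _]mkseq_nth.
by apply: computed_comp => // -[|i] ik //; apply: computed_nth.
Qed.

Lemma computed_add k F G :
  computed k F -> computed k G -> computed k (fun v => F v + G v).
Proof.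
move=> cF cG.
apply: (@eq_computed _ (fun v => iteri (F v) (fun i a => a.+1) (G v))).
  by move=> v _; elim: (F v) => //= n ->.
apply: (computed_iteri (H := fun w => (nth 0 w 1).+1)) => //.
exact/computed_succ/computed_nth.
Qed.

Lemma computed_mul k F G :
  computed k F -> computed k G -> computed k (fun v => F v * G v).
Proof.
move=> cF cG.
apply: (@eq_computed _ (fun v =>
    iteri (F v) (fun i a => G (drop 2 [:: i, a & v]) + a) 0)).
  by move=> v _; elim: (F v) => //= n ->; rewrite drop0 mulSn.
apply: (computed_iteri (H := fun w => G (drop 2 w) + nth 0 w 1) (G := fun=> 0)) => //.
  exact: computed_const.
by apply: computed_add; [exact: (computed_drop 2) | exact: computed_nth].
Qed.

Lemma computed_sub k F G :
  computed k F -> computed k G -> computed k (fun v => F v - G v).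
Proof.
(* The predecessor is the index of the last round of a loop of [K v] rounds. *)
have cpred l K : computed l K -> computed l (fun v => (K v).-1).
  move=> cK; apply: (@eq_computed _ (fun v => iteri (K v) (fun i a => i) 0)).
    by move=> v _; case: (K v).
  apply: (computed_iteri (H := fun w => nth 0 w 0) (G := fun=> 0)) => //.
    exact: computed_const.
  exact: computed_nth.
move=> cF cG.
apply: (@eq_computed _ (fun v => iteri (G v) (fun i a => a.-1) (F v))).
  by move=> v _; elim: (G v) => [|n IHn] /=; rewrite ?subn0 // IHn subnS.
apply: (computed_iteri (H := fun w => (nth 0 w 1).-1)) => //.
exact/cpred/computed_nth.
Qed.

Lemma computed_prod k B F :
  computed k B -> computed k.+1 F ->
  computed k (fun v => \prod_(i < B v) F (nat_of_ord i :: v)).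
Proof.
move=> cB cF.
apply: (@eq_computed _ (fun v => iteri (B v) (fun i a => a * F (i :: v)) 1)).
  by move=> v _; elim: (B v) => [|n IHn]; rewrite ?big_ord0 // big_ord_recr /= IHn.
(* [S] skips entry 1, the accumulator, turning [[:: i, a & v]] into [i :: v]. *)
pose S i w := nth 0 w (if i is j.+1 then j.+2 else 0).
apply: (@eq_computed _ (fun v => iteri (B v) (fun i a =>
    (fun w => nth 0 w 1 * F (mkseq (S^~ w) k.+1)) [:: i, a & v]) 1)).
  move=> v sv; apply: eq_iteri => i a /=; congr (a * F _).
  by rewrite /mkseq /= (iotaDl 1 0) -map_comp -[in iota 0 k]sv [map _ _]mkseq_nth.
apply: (computed_iteri (G := fun=> 1)
  (H := fun w => nth 0 w 1 * F (mkseq (S^~ w) k.+1))) => //; first exact: computed_const.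
apply: computed_mul; first exact: computed_nth.
by apply: computed_comp => // -[|i] ik; exact: computed_nth.
Qed.

Lemma computed_exp k F G :
  computed k F -> computed k G -> computed k (fun v => F v ^ G v).
Proof.
move=> cF cG.
apply: (@eq_computed _ (fun v => \prod_(i < G v) F (drop 1 (nat_of_ord i :: v)))).
  by move=> v _; rewrite /= drop0 prod_nat_const card_ord.
exact: (computed_prod (F := fun w => F (drop 1 w)) cG (computed_drop 1 cF)).
Qed.

(** With 0 read as truth, a product is a bounded existential quantifier, since it vanishes exactly
    when some factor does. *)
Fixpoint search (m : nat) (B F : seq nat -> nat) (v : seq nat) : nat :=
  if m is m'.+1 then \prod_(i < B v) search m' B F (nat_of_ord i :: v) else F v.

(** The list grows by one entry per level, so [B] must be computed at every arity from [k] on. *)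
Lemma computed_search m k B F :
  (forall j, k <= j -> computed j B) -> computed (m + k) F ->
  computed k (search m B F).
Proof.
elim: m k => [|m IHm] k cB cF //=.
apply: (@computed_prod k B (search m B F)); first exact: cB.
apply: IHm => [j kj|]; last by rewrite addnS.
by apply: cB; apply: ltnW.
Qed.

(** Pushing candidates in front of a nonempty list keeps its last entry, so every level searches
    below the same bound. *)
Lemma search_eq0 m (B : nat -> nat) F v : 0 < size v ->
  search m (fun w => B (last 0 w)) F v = 0 <->
  exists x, [/\ size x = m, all (fun i => i < B (last 0 v)) x & F (x ++ v) = 0].
Proof.
elim: m v => [|m IHm] v v0 /=.
  by split=> [F0|[x [/size0nil-> _ F0]]] //; exists [::].
have lastE i : last i v = last 0 v by case: v v0.
split=> [/eqP|[x [sx xB F0]]].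
  (* The value chosen at the outermost level ends up next to [v], hence last in the witness. *)
  rewrite prod_nat_seq_eq0 => /hasP[i _ /= /eqP /IHm[//|x [sx]]].
  rewrite /= lastE => xB F0; exists (rcons x i).
  by rewrite size_rcons sx all_rcons ltn_ord cat_rcons.
case: (lastP x) sx xB F0 => // x' i; rewrite size_rcons all_rcons cat_rcons.
move=> [sx] /andP[iB xB] F0; apply/eqP; rewrite prod_nat_seq_eq0; apply/hasP.
exists (Ordinal iB); first exact: mem_index_enum.
by apply/eqP/IHm => //=; exists x'; rewrite lastE.
Qed.

(** * Polynomials and positive expressions *)

(** Without zero and subtraction, all values at positive arguments are positive and can be carried
    by variables of a system. *)
Inductive expr (k : nat) : Type :=
| One
| Var of 'I_k
| Add of expr k & expr k
| Mul of expr k & expr k.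
Arguments One {k}.

Fixpoint eval (k : nat) (e : expr k) (u : seq nat) : nat :=
  match e with
  | One => 1
  | Var i => nth 0 u i
  | Add a b => eval a u + eval b u
  | Mul a b => eval a u * eval b u
  end.

Lemma computed_eval k (e : expr k) : computed k (eval e).
Proof.
elim: e => [|i|a IHa b IHb|a IHa b IHb] /=.
- exact: computed_const.
- exact: computed_nth.
- exact: computed_add.
- exact: computed_mul.
Qed.

Definition difference_of_exprs (k : nat) (phi : seq nat -> int) : Prop :=
  exists P Q : expr k, forall u, phi u = ((eval P u)%:Z - (eval Q u)%:Z)%R.

Lemma difference_add k phi psi :
  difference_of_exprs k phi -> difference_of_exprs k psi ->
  difference_of_exprs k (fun u => phi u + psi u)%R.
Proof.
move=> [P [Q e]] [P' [Q' e']]; exists (Add P P'), (Add Q Q') => u.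
by rewrite e e' /= !PoszD; ring.
Qed.

Lemma difference_mul k phi psi :
  difference_of_exprs k phi -> difference_of_exprs k psi ->
  difference_of_exprs k (fun u => phi u * psi u)%R.
Proof.
move=> [P [Q e]] [P' [Q' e']].
exists (Add (Mul P P') (Mul Q Q')), (Add (Mul P Q') (Mul Q P')) => u.
by rewrite e e' /= !PoszD !PoszM; ring.
Qed.

(** Zero is written as 1 - 1; positive constants enlarge the left expression, negative ones the
    right. *)
Lemma difference_const k (c : int) : difference_of_exprs k (fun=> c).
Proof.
elim/int_ind: c => [|n [P [Q e]]|n [P [Q e]]].
- by exists One, One.
- by exists (Add P One), Q => u; have := e u; rewrite /= PoszD; lia.
- by exists P, (Add Q One) => u; have := e u; rewrite /= PoszD; lia.
Qed.

Lemma difference_sum k I (r : seq I) (phi : I -> seq nat -> int) :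
  (forall i, difference_of_exprs k (phi i)) ->
  difference_of_exprs k (fun u => \sum_(i <- r) phi i u)%R.
Proof.
move=> dphi; elim: r => [|i r [P [Q e]]].
  by exists One, One => u; rewrite big_nil.
have [P' [Q' e']] := difference_add (dphi i) (ex_intro _ P (ex_intro _ Q e)).
by exists P', Q' => u; rewrite big_cons e'.
Qed.

Lemma difference_prod k I (r : seq I) (phi : I -> seq nat -> int) :
  (forall i, difference_of_exprs k (phi i)) ->
  difference_of_exprs k (fun u => \prod_(i <- r) phi i u)%R.
Proof.
move=> dphi; elim: r => [|i r [P [Q e]]].
  by exists (Add One One), One => u; rewrite big_nil.
have [P' [Q' e']] := difference_mul (dphi i) (ex_intro _ P (ex_intro _ Q e)).
by exists P', Q' => u; rewrite big_cons e'.
Qed.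

Lemma difference_exp k phi n : difference_of_exprs k phi ->
  difference_of_exprs k (fun u => phi u ^+ n)%R.
Proof.
move=> dphi; elim: n => [|n [P [Q e]]].
  by exists (Add One One), One.
have [P' [Q' e']] := difference_mul dphi (ex_intro _ P (ex_intro _ Q e)).
by exists P', Q' => u; rewrite exprS e'.
Qed.

(* The shift by 1 turns unknowns in N into positive unknowns. *)
Lemma difference_mpoly k (W : {mpoly int[k]}) :
  difference_of_exprs k
    (fun u => W.@[fun i => (nth 0 u (nat_of_ord i))%:Z - 1])%R.
Proof.
(* Evaluation unfolds to a sum, over the support, of coefficients times products of powers. *)
apply: difference_sum => mon; apply: difference_mul.
  exact: difference_const.
apply: difference_prod => i; apply: difference_exp.
by exists (Var i), One.
Qed.

(** * Systems with uniquely determined auxiliary variables *)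

(* [inl (i, k)] stands for x_i + 1 = x_k and [inr (i, j, k)] for x_i x_j = x_k. *)
Definition nat_equation : Type := (nat * nat + nat * nat * nat)%type.

Definition holds (x : seq nat) (e : nat_equation) : bool :=
  match e with
  | inl (i, k) => nth 0 x i + 1 == nth 0 x k
  | inr (i, j, k) => nth 0 x i * nth 0 x j == nth 0 x k
  end.

Definition below (n : nat) (e : nat_equation) : bool :=
  match e with
  | inl (i, k) => (i < n) && (k < n)
  | inr (i, j, k) => [&& i < n, j < n & k < n]
  end.

Definition positive (x : seq nat) : bool := all (fun a => 0 < a) x.

Lemma positive_cat x y : positive (x ++ y) = positive x && positive y.
Proof. exact: all_cat. Qed.

Lemma nth_catl n (x y : seq nat) i : size x = n -> i < n ->
  nth 0 (x ++ y) i = nth 0 x i.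
Proof. by move=> <- i_n; rewrite nth_cat i_n. Qed.

Lemma nth_catr n (x y : seq nat) i : size x = n ->
  nth 0 (x ++ y) (n + i) = nth 0 y i.
Proof. by move=> <-; rewrite nth_cat ltnNge leq_addr addKn. Qed.

Lemma nth_catn n (x y : seq nat) z : size x = n -> nth 0 (x ++ z :: y) n = z.
Proof. by move=> sx; rewrite nth_cat sx ltnn subnn. Qed.

Lemma nth_positive x i : positive x -> i < size x -> 0 < nth 0 x i.
Proof. by move=> /all_nthP; apply. Qed.

Lemma all_holds_cat n (x y : seq nat) (L : seq nat_equation) : size x = n ->
  all (below n) L -> all (holds (x ++ y)) L = all (holds x) L.
Proof.
move=> sx /allP Ln; apply: eq_in_all => e /Ln.
by case: e => [[i k]|[[i j] k]] /= => [/andP[]|/and3P[]] *;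
  rewrite !(nth_catl _ sx).
Qed.

Lemma below_widen n m e : n <= m -> below n e -> below m e.
Proof. by case: e => [[i k]|[[i j] k]] /=; lia. Qed.

(* Given positive values x of the first n variables, the only positive values
   of the last m variables satisfying the system L are g x. *)
Definition block (n m : nat) (L : seq nat_equation) (g : seq nat -> seq nat) : Prop :=
  all (below (n + m)) L /\
  forall x, size x = n -> positive x ->
    [/\ size (g x) = m, positive (g x) &
      forall y, size y = m -> positive y -> all (holds (x ++ y)) L = (y == g x)].

Definition join (g g' : seq nat -> seq nat) (x : seq nat) : seq nat :=
  g x ++ g' (x ++ g x).

(** [L] does not mention the last [m'] variables, so it forces the middle ones to be [g x]; then
    [L'] is read over [x ++ g x]. *)
Lemma block_join n m m' L L' g g' : block n m L g -> block (n + m) m' L' g' ->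
  block n (m + m') (L ++ L') (join g g').
Proof.
move=> [Ln Hg] [Ln' Hg']; split.
  rewrite all_cat addnA Ln' andbT; apply: sub_all Ln => e.
  by apply: below_widen; rewrite leq_addr.
move=> x sx px; have [sg pg gE] := Hg x sx px.
have [||sg' pg' gE'] := Hg' (x ++ g x).
- by rewrite size_cat sx sg.
- by rewrite positive_cat px.
split; rewrite /join.
- by rewrite size_cat sg sg'.
- by rewrite positive_cat pg.
move=> y sy; rewrite -(cat_take_drop m y).
have sy1 : size (take m y) = m by rewrite size_take sy; case: ifP; lia.
have sy2 : size (drop m y) = m' by rewrite size_drop sy addKn.
move: (take m y) (drop m y) sy1 sy2 => y1 y2 sy1 sy2.
rewrite positive_cat => /andP[py1 py2].
rewrite eqseq_cat ?sy1 ?sg // catA all_cat.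
rewrite (@all_holds_cat (n + m)) ?size_cat ?sx ?sy1 // gE //.
by case: eqP => //= ->; exact: gE'.
Qed.

Lemma block_nil n : block n 0 [::] (fun=> [::]).
Proof. by split=> // x sx px; split=> // -[]. Qed.

(** The only positive idempotent of multiplication is 1. *)
Lemma block_one n : block n 1 [:: inr (n, n, n)] (fun=> [:: 1]).
Proof.
split=> [|x sx px]; first by rewrite /= addn1 ltnSn.
split=> // -[//|z [|//]] _ /= /andP[z0 _].
by rewrite (nth_catn _ _ sx) andbT eqseq_cons andbT; nia.
Qed.

Lemma block_succ n i : i < n ->
  block n 1 [:: inl (i, n)] (fun x => [:: nth 0 x i + 1]).
Proof.
move=> i_n; split=> [|x sx px]; first by rewrite /=; lia.
split=> //=; first by rewrite addn1.
move=> [//|z [|//]] _ _ /=.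
by rewrite (nth_catn [::] z sx) (nth_catl _ sx) // !andbT eqseq_cons andbT eq_sym.
Qed.

Lemma block_mul n i j : i < n -> j < n ->
  block n 1 [:: inr (i, j, n)] (fun x => [:: nth 0 x i * nth 0 x j]).
Proof.
move=> i_n j_n; split=> [|x sx px]; first by rewrite /=; lia.
split=> //=; first by rewrite muln_gt0 !nth_positive ?sx.
move=> [//|z [|//]] _ _ /=.
by rewrite (nth_catn [::] z sx) !(nth_catl _ sx) // !andbT eqseq_cons andbT eq_sym.
Qed.

(* J. Robinson: for z > 0, the equation a + b = z is equivalent to
   (za + 1)(zb + 1) = z^2 (ab + 1) + 1. *)
Lemma block_add n i j : i < n -> j < n ->
  exists L g, block n 10 L g /\
    forall x, size x = n -> nth 0 (x ++ g x) n = nth 0 x i + nth 0 x j.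
Proof.
move=> i_n j_n.
(* Variable [n] is z, written [n + 0] to fit [nth_catr]. Variable [n + 5] carries the left side of
   the identity, [n + 9] the product z^2 (ab + 1); only the last equation ties z to a and b. *)
exists [:: inr (n + 0, i, n + 1); inl (n + 1, n + 2);
  inr (n + 0, j, n + 3); inl (n + 3, n + 4); inr (n + 2, n + 4, n + 5);
  inr (i, j, n + 6); inl (n + 6, n + 7); inr (n + 0, n + 0, n + 8);
  inr (n + 8, n + 7, n + 9); inl (n + 9, n + 5)].
exists (fun x => let a := nth 0 x i in let b := nth 0 x j in let z := a + b in
  [:: z; z * a; z * a + 1; z * b; z * b + 1; (z * a + 1) * (z * b + 1);
      a * b; a * b + 1; z * z; z * z * (a * b + 1)]).
split; last by move=> x sx; rewrite (nth_catn _ _ sx).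
split=> [|x sx px]; first by rewrite /=; lia.
have := nth_positive px; rewrite sx => px'.
have := px' i i_n; have := px' j j_n.
set a := nth 0 x i; set b := nth 0 x j => b0 a0.
split=> //=; first by rewrite !muln_gt0 /=; nia.
move=> [//|z [//|za [//|za1 [//|zb [//|zb1 [//|c [//|ab [//|ab1 [//|zz]]]]]]]]].
move=> [//|d [|//]] _.
rewrite /= !(nth_catr _ _ sx) !(nth_catl _ sx) // -/a -/b /=.
move=> /andP[z0 _].
rewrite !eqseq_cons; apply/idP/idP; last first.
  move=>
    /andP[/eqP-> /andP[/eqP-> /andP[/eqP-> /andP[/eqP-> /andP[/eqP-> /andP[/eqP-> /andP[/eqP-> /andP[/eqP-> /andP[/eqP-> /andP[/eqP-> _]]]]]]]]]].
  by rewrite !eqxx /= andbT; apply/eqP; ring.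
move=> /andP[/eqP<- /andP[/eqP<- /andP[/eqP<- /andP[/eqP<- /andP[/eqP<- /andP[/eqP<- /andP[/eqP<- /andP[/eqP<- /andP[/eqP<- /andP[/eqP E _]]]]]]]]]].
(* Expanding the identity leaves z (a + b) = z z, from which z > 0 is cancelled. *)
have zE : z = a + b.
  apply/eqP; rewrite -(eqn_pmul2l z0); apply/eqP.
  by move: E; rewrite !mulnDr !mulnDl; lia.
by rewrite zE !eqxx.
Qed.

(** * Compilation of expressions into systems *)

Lemma cat_join g g' x : x ++ join g g' x = (x ++ g x) ++ g' (x ++ g x).
Proof. exact: catA. Qed.

Lemma eval_cat k (e : expr k) x y : k <= size x -> eval e (x ++ y) = eval e x.
Proof.
move=> kx; elim: e => [|i|a IHa b IHb|a IHa b IHb] //=; try by rewrite IHa IHb.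
by rewrite nth_cat (leq_trans (ltn_ord i) kx).
Qed.

Definition compilable (n : nat) (phi : seq nat -> nat) : Prop :=
  exists m L g r, [/\ block n m L g, r < n + m &
    forall x, size x = n -> positive x -> nth 0 (x ++ g x) r = phi x].

(** The second operand is compiled over the variables of the first, and the block of [op] comes
    last. Its result is its first new variable, which exists because of [m.+1]. *)
Lemma compilable_op (op : nat -> nat -> nat) k (a b : expr k) n :
  (forall n i j, i < n -> j < n -> exists m L g, block n m.+1 L g /\
    forall x, size x = n -> nth 0 (x ++ g x) n = op (nth 0 x i) (nth 0 x j)) ->
  (forall n, k <= n -> compilable n (eval a)) ->
  (forall n, k <= n -> compilable n (eval b)) ->
  k <= n -> compilable n (fun x => op (eval a x) (eval b x)).
Proof.
move=> opP aP bP kn.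
have [m1 [L1 [g1 [r1 [B1 r1n H1]]]]] := aP n kn.
have [m2 [L2 [g2 [r2 [B2 r2n H2]]]]] := bP (n + m1) (leq_trans kn (leq_addr _ _)).
have [||m3 [L3 [g3 [B3 H3]]]] := opP (n + m1 + m2) r1 r2 => //.
  by rewrite (leq_trans r1n) ?leq_addr.
exists (m1 + (m2 + m3.+1)), (L1 ++ (L2 ++ L3)), (join g1 (join g2 g3)), (n + m1 + m2).
split; [exact: block_join B1 (block_join B2 B3) | by lia |] => x sx px.
have [s1 p1 _] := B1.2 x sx px.
have sx1 : size (x ++ g1 x) = n + m1 by rewrite size_cat sx s1.
have px1 : positive (x ++ g1 x) by rewrite positive_cat px.
have [s2 _ _] := B2.2 _ sx1 px1.
rewrite !cat_join H3; last by rewrite size_cat sx1 s2.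
by rewrite (nth_catl _ sx1) // H1 // H2 // eval_cat ?sx.
Qed.

Lemma compilable_eval k (e : expr k) n : k <= n -> compilable n (eval e).
Proof.
elim: e n => [|i|a IHa b IHb|a IHa b IHb] n kn.
- exists 1, [:: inr (n, n, n)], (fun=> [:: 1]), n.
  by split=> [||x sx _]; [exact: block_one | rewrite addn1 | rewrite (nth_catn _ _ sx)].
- exists 0, [::], (fun=> [::]), i.
  split=> [||x _ _]; [exact: block_nil | rewrite addn0 | by rewrite cats0].
  exact: leq_trans (ltn_ord i) kn.
- apply: (compilable_op (op := addn)) => // l i j i_l j_l.
  by have [L [g Lg]] := block_add i_l j_l; exists 9, L, g.
- apply: (compilable_op (op := muln)) => // l i j i_l j_l.
  exists 0, [:: inr (i, j, l)], (fun x => [:: nth 0 x i * nth 0 x j]).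
  by split=> [|x sx]; [exact: block_mul | rewrite (nth_catn _ _ sx)].
Qed.

(** Both ends of the chain are recorded: the last is the shifted parameter, and the 1 serves to
    state equalities of variables as products. *)
Lemma block_chain n b : exists L g, block n b.+1 L g /\
  forall x, size x = n -> positive x ->
    nth 0 (x ++ g x) n = 1 /\ nth 0 (x ++ g x) (n + b) = b.+1.
Proof.
elim: b => [|b [L [g [B Hg]]]].
  exists [:: inr (n, n, n)], (fun=> [:: 1]); split; first exact: block_one.
  by move=> x sx _; rewrite addn0 (nth_catn _ _ sx).
have nb : n + b < n + b.+1 by rewrite ltn_add2l.
exists (L ++ [:: inl (n + b, n + b.+1)]).
exists (join g (fun x => [:: nth 0 x (n + b) + 1])); split.
  by rewrite -[in block _ _]addn1; apply: block_join => //; exact: block_succ.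
move=> x sx px; rewrite cat_join; have [g1 gb] := Hg x sx px.
have sxg : size (x ++ g x) = n + b.+1 by rewrite size_cat sx; have [->] := B.2 x sx px.
by rewrite (nth_catn _ _ sxg) gb addn1 (nth_catl _ sxg) //; lia.
Qed.

(* The last b + 1 variables are forced to be 1, ..., b + 1, and the first
   variable, which carries the shifted parameter, to be equal to the last one. *)
Lemma equation_system m (P Q : expr m.+1) : exists N, forall b,
  exists (L : seq nat_equation) (h : seq nat -> seq nat), all (below (N + b)) L /\
    forall u, size u = m.+1 -> positive u ->
      [/\ size (u ++ h u) = N + b, positive (u ++ h u) &
        forall y, size y = N + b - m.+1 -> positive y ->
          all (holds (u ++ y)) L =
            [&& y == h u, nth 0 u 0 == b.+1 & eval P u == eval Q u]].
Proof.
have [m1 [L1 [g1 [r1 [B1 r1n H1]]]]] := compilable_eval P (leqnn m.+1).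
have [m2 [L2 [g2 [r2 [B2 r2n H2]]]]] := compilable_eval Q (leq_addr m1 m.+1).
(* The chain has b + 1 variables; the extra one is counted in the constant part [n.+1]. *)
pose n := m.+1 + m1 + m2; exists n.+1 => b.
have [L3 [g3 [B3 H3]]] := block_chain n b.
pose L := L1 ++ (L2 ++ L3); pose h := join g1 (join g2 g3).
have B : block m.+1 (m1 + (m2 + b.+1)) L h := block_join B1 (block_join B2 B3).
have nE : m.+1 + (m1 + (m2 + b.+1)) = n.+1 + b by rewrite /n; lia.
(* Variable [n] is the 1 of the chain, so these products say that variable 0 equals b + 1 and that
   the values of [P] and [Q] agree. *)
exists (L ++ [:: inr (0, n, n + b); inr (r1, n, r2)]), h; split.
  by rewrite all_cat -{1}nE B.1 /= /n; lia.
move=> u su pu; have [sh ph hE] := B.2 u su pu; split.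
- by rewrite size_cat su sh nE.
- by rewrite positive_cat pu.
rewrite -nE addKn => y sy py; rewrite all_cat hE //.
case: eqP => //= ->; rewrite andbT.
have [s1 p1 _] := B1.2 u su pu.
have sx1 : size (u ++ g1 u) = m.+1 + m1 by rewrite size_cat su s1.
have px1 : positive (u ++ g1 u) by rewrite positive_cat pu.
have [s2 p2 _] := B2.2 _ sx1 px1.
have e1 := H1 u su pu; have e0 := nth_catl (g1 u) su (ltn0Sn m).
rewrite /h !cat_join -(eval_cat Q (g1 u)) ?su //.
move: (u ++ g1 u) sx1 px1 s2 p2 e1 e0 => x1 sx1 px1 s2 p2 e1 e0.
have sx2 : size (x1 ++ g2 x1) = n by rewrite size_cat sx1 s2.
have px2 : positive (x1 ++ g2 x1) by rewrite positive_cat px1.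
have [-> ->] := H3 _ sx2 px2.
rewrite !(nth_catl _ sx2) ?muln1 //; last by rewrite /n; lia.
by rewrite H2 // !(nth_catl _ sx1) // e1 e0.
Qed.

(** * Applying the Conjecture to the compiled systems *)

Definition erase (n : nat) (e : equation n) : nat_equation :=
  match e with
  | EqSucc i k => inl (nat_of_ord i, nat_of_ord k)
  | EqMul i j k => inr (nat_of_ord i, nat_of_ord j, nat_of_ord k)
  end.

Definition system (n : nat) (L : seq nat_equation) : set (equation n) :=

  [set e | erase e \in L]%classic.

Lemma satisfies_holds n (z : n.-tuple nat) (e : equation n) :
  satisfies z e <-> holds z (erase e).
Proof.
by case: e => [i k|i j k] /=; rewrite !(tnth_nth 0); split=> /eqP.
Qed.

(** Since [L] stays below [n], each of its equations is the erasure of one indexed by ['I_n], so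
    [system] loses none. *)
Lemma positive_solutionsE n L (z : n.-tuple nat) : all (below n) L ->
  positive_solutions (@system n L) z <-> positive z && all (holds z) L.
Proof.
move=> /allP Ln; split=> [[z0 zT]|/andP[/allP z0 /allP zL]].
  apply/andP; split; first by apply/all_tnthP.
  apply/allP => e eL; have := Ln e eL.
  case: e eL => [[i k]|[[i j] k]] eL /= => [/andP[i_n k_n]|/and3P[i_n j_n k_n]].
    by have /satisfies_holds := zT (EqSucc (Ordinal i_n) (Ordinal k_n)) eL.
  by have /satisfies_holds :=
    zT (EqMul (Ordinal i_n) (Ordinal j_n) (Ordinal k_n)) eL.
split=> [i|e eL]; first by apply: z0; exact: mem_tnth.
by apply/satisfies_holds/zL.
Qed.

Lemma mpoly_exprs m (W : {mpoly int[m.+1]}) : exists P Q : expr m.+1,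
  forall b x, natural_solutions W b x <->
    eval P (map succn (b :: x)) = eval Q (map succn (b :: x)).
Proof.
have [P [Q PQ]] := difference_mpoly W; exists P, Q => b x.
have -> : natural_solutions W b x <->
    (W.@[fun i => (nth 0 (map succn (b :: x)) (nat_of_ord i))%:Z - 1] = 0)%R.
  rewrite /natural_solutions /=.
  suff -> : (fun i : 'I_m.+1 => Posz (tnth (cons_tuple b x) i)) =
    (fun i => (nth 0 (map succn (b :: x)) (nat_of_ord i))%:Z - 1)%R by [].
  apply: funext => i; rewrite (tnth_nth 0) (nth_map 0) ?size_tuple //.
  by rewrite intS addrAC subrr add0r.
rewrite PQ; lia.
Qed.

Lemma solution_bound m (W : {mpoly int[m.+1]}) :
  (forall (n : nat) (T : set (equation n)),
      0 < n ->
      finite_set (positive_solutions T) ->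
      forall x : n.-tuple nat,
        positive_solutions T x -> forall i : 'I_n, tnth x i <= f n) ->
  exists N, forall b, finite_set (natural_solutions W b) ->
    forall x, natural_solutions W b x -> all (fun a => a < f (N + b)) x.
Proof.
move=> conj; have [P [Q PQ]] := mpoly_exprs W.
have [N HN] := equation_system P Q; exists N => b finW.
have [L [h [Ln Hh]]] := HN b; set n := N + b in Ln Hh *.
pose u (x : m.-tuple nat) := map succn (b :: x).
have su x : size (u x) = m.+1 by rewrite size_map /= size_tuple.
have pu x : positive (u x) by rewrite /positive /u all_map; exact/allP.
(* The default tuple never occurs: the list has length [n], as [zE] checks. *)
pose z (x : m.-tuple nat) : n.-tuple nat := insubd (nseq_tuple n 0) (u x ++ h (u x)).
have zE x : z x = u x ++ h (u x) :> seq nat.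
  by rewrite val_insubd; have [-> _ _] := Hh _ (su x) (pu x); rewrite eqxx.
(* Every positive solution is some [z x]: its first m + 1 values, lowered by 1, are b and a solution
   x, and the others are forced. Finiteness thus passes from [W] to the system. *)
have finT : finite_set (positive_solutions (@system n L)).
  apply: (sub_finite_set _ (finite_image z finW)) => y.
  move=> /(positive_solutionsE _ Ln)/andP[py Ly].
  have := cat_take_drop m.+1 y; set u' := take _ _; set y' := drop _ _ => yE.
  have mn : m.+1 <= n.
    have [<- _ _] := Hh _ (su (nseq_tuple m 0)) (pu _).
    by rewrite size_cat su leq_addr.
  have su' : size u' = m.+1 by rewrite size_takel ?size_tuple.
  have sy' : size y' = n - m.+1 by rewrite size_drop size_tuple.
  move: py Ly; rewrite -yE positive_cat => /andP[pu' py'].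
  have [_ _ ->] // := Hh u' su' pu'; case/and3P=> /eqP y'E /eqP u0 /eqP uPQ.
  have sx : size (map predn (behead u')) == m by rewrite size_map size_behead su'.
  have uE : u' = u (Tuple sx).
    rewrite /u /= -map_comp; case: (u') su' u0 pu' => //= a r _ -> /andP[_ /allP pr].
    by congr (_ :: _); rewrite -[LHS]map_id; apply/eq_in_map => i /pr /= /prednK.
  exists (Tuple sx); first by apply/PQ; rewrite -[map _ _]uE.
  by apply: val_inj; rewrite /= zE -yE y'E -uE.
move=> x Wx; have [sz pz Hz] := Hh _ (su x) (pu x).
have sh : size (h (u x)) = n - m.+1 by rewrite -sz size_cat su addKn.
have Tz : positive_solutions (@system n L) (z x).
  apply/(positive_solutionsE _ Ln); rewrite zE pz Hz //; last first.
    by move: pz; rewrite positive_cat => /andP[].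
  by rewrite !eqxx /=; apply/eqP/PQ.
apply/(all_nthP 0) => i; rewrite size_tuple => im.
have i_n : i.+1 < n by rewrite -sz size_cat su; lia.
(* Entry i of x sits at index i + 1, increased by 1, so the bound of the Conjecture becomes
   strict. *)
have := conj n _ (leq_ltn_trans (leq0n _) i_n) finT _ Tz (Ordinal i_n).
by rewrite (tnth_nth 0) zE /= nth_cat size_map size_tuple im (nth_map 0) ?size_tuple.
Qed.

(** * Deciding membership by bounded search *)

Lemma f_le n : f n <= (2 + 2 ^ 2 ^ n) ^ 2 ^ n.
Proof.
have le_exp i : i <= n -> (2 + 2 ^ 2 ^ i) ^ 2 ^ i <= (2 + 2 ^ 2 ^ n) ^ 2 ^ n.
  move=> i_n; apply: (@leq_trans ((2 + 2 ^ 2 ^ n) ^ 2 ^ i)).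
    by rewrite leq_exp2r ?expn_gt0 // leq_add2l !leq_exp2l.
  by rewrite !leq_exp2l //; have := expn_gt0 2 (2 ^ n); lia.
rewrite /f; case: ifP => _; first by rewrite expn_gt0.
case: ifP => _; last by apply: le_exp; exact: leq_subr.
apply: leq_trans (le_exp (n - 2) (leq_subr _ _)).
apply: (@leq_trans (2 + 2 ^ 2 ^ (n - 2))); first exact: leq_addl.
by rewrite -[X in X <= _]expn1 leq_exp2l ?expn_gt0 //; have := expn_gt0 2 (2 ^ (n - 2)); lia.
Qed.

Theorem theorem5 :
  (forall (n : nat) (T : set (equation n)),
      0 < n ->
      finite_set (positive_solutions T) ->
      forall x : n.-tuple nat,
        positive_solutions T x -> forall i : 'I_n, tnth x i <= f n) ->
  forall M : set nat, finite_fold_diophantine M -> computable M.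
Proof.
move=> conj M [m [W [MW finW]]].
have [N HN] := solution_bound W conj; have [P [Q PQ]] := mpoly_exprs W.
(* By [f_le] this dominates [f (N + b)]; being free of case distinctions, it is computed from sums
   and powers alone. *)
pose B b := (2 + 2 ^ 2 ^ (N + b)) ^ 2 ^ (N + b).
(* The search presents the list [rev x ++ [:: b]]; reading it backwards and adding 1 restores the
   shifted [b :: x]. *)
pose U w := mkseq (fun i => (nth 0 w (m - i)).+1) m.+1.
(* With truncated subtraction this is the distance of the two values, zero exactly when they
   agree. *)
pose F w := (eval P (U w) - eval Q (U w)) + (eval Q (U w) - eval P (U w)).
have cF : computed m.+1 F.
  have cU (e : expr m.+1) : computed m.+1 (fun w => eval e (U w)).
    apply: (computed_comp (H := fun i w => (nth 0 w (m - i)).+1)).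
      exact: computed_eval.
    by move=> i _; apply/computed_succ/computed_nth; rewrite ltnS leq_subr.
  by apply: computed_add; exact: computed_sub.
have cB j : 0 < j -> computed j (fun w => B (last 0 w)).
  move=> j0; have cN : computed j (fun w => N + last 0 w).
    apply: computed_add; first exact: computed_const.
    apply: (@eq_computed _ (fun w => nth 0 w j.-1)).
      by move=> w <-; exact: nth_last.
    by apply: computed_nth; rewrite prednK.
  have c2N : computed j (fun w => 2 ^ (N + last 0 w)).
    exact: computed_exp (computed_const _ _) cN.
  apply: computed_exp => //; apply: computed_add; first exact: computed_const.
  exact: computed_exp (computed_const _ _) c2N.
pose S v := search m (fun w => B (last 0 w)) F v.
have cS : computed 1 S by apply: computed_search => //; rewrite addn1.
have MS b : M b <-> S [:: b] = 0.
  rewrite MW search_eq0 //.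
  have FE (x : m.-tuple nat) : F (rev x ++ [:: b]) = 0 <-> natural_solutions W b x.
    rewrite PQ /F; suff -> : U (rev x ++ [:: b]) = map succn (b :: x) by lia.
    apply: (@eq_from_nth _ 0).
      by rewrite size_mkseq size_map /= size_tuple.
    move=> i; rewrite size_mkseq => im; rewrite nth_mkseq // (nth_map 0) ?size_tuple //=.
    rewrite cats1 -rev_cons nth_rev /= ?size_tuple; last by lia.
    by congr (nth _ _ _).+1; lia.
  split=> [[x Wx]|[x [sx _ Fx]]].
    exists (rev x); rewrite size_rev size_tuple all_rev; split=> //.
      apply: sub_all (HN b (finW b) x Wx) => a /= /leq_trans; apply.
      exact: f_le.
    exact/FE.
  have sx' : size (rev x) == m by rewrite size_rev sx.
  by exists (Tuple sx'); apply/FE; rewrite /= revK.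
(* As 0 ^ 0 = 1 and 0 ^ s = 0 for s > 0, this is the characteristic function of [M]. *)
have [c Hc] : computed 1 (fun v => 0 ^ S v).
  by apply: computed_exp => //; exact: computed_const.
exists c => b; split=> [/MS Sb|Mb]; have := Hc [tuple b].
  by rewrite /= Sb.
by rewrite exp0n // lt0n; apply/eqP => /MS.
Qed.
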